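(* Let $X$ be a smooth projective curve over $\mathbb{C}$ and $n\ge1$. Then $$\mathrm{M}_n\times_{\mathrm{H}}\mathrm{V}=\mathrm{Bor},$$ i.e. the preimage under the Hitchin map $h:\mathrm{M}_n\to\mathrm{H}$ of the locus $\mathrm{V}\subset\mathrm{H}$ of totally reducible spectral curves is the locus $\mathrm{Bor}$ of Higgs bundles whose structure group reduces to a Borel subgroup.
   Context: $K$ is the canonical bundle of $X$. $\mathrm{M}_n$ is the moduli space of semistable Higgs bundles $(E,\varphi)$, $\varphi\in H^0(X,\mathrm{End}(E)\otimes K)$, of rank $n$ and degree $0$; its points are isomorphism classes of polystable Higgs bundles. The Hitchin map $h:\mathrm{M}_n\to\mathrm{H}=\bigoplus_{i=1}^nH^0(X,K^i)$ sends $(E,\varphi)$ to $(q_1(\varphi),\dots,q_n(\varphi))$, where $q_1,\dots,q_n$ are the coefficients of the characteristic polynomial (a homogeneous basis, $\deg q_i=i$, of the invariant polynomials on $\mathfrak{gl}(n,\mathbb{C})$). $\mathrm{V}=\mathrm{Sym}^n(H^0(X,K))$ is embedded in $\mathrm{H}$ by sending the orbit $(\alpha_1,\dots,\alpha_n)_{\mathfrak{S}_n}$ to $(q_1(\alpha_1,\dots,\alpha_n),\dots,q_n(\alpha_1,\dots,\alpha_n))$, the values of the $q_i$ on the diagonal Higgs field with entries $\alpha_i$. Fix a Borel subgroup $\mathrm{B}\subset\mathrm{GL}(n,\mathbb{C})$ with Lie algebra $\mathfrak{b}$. Then $$\mathrm{Bor}=\{(E,\varphi)\in\mathrm{M}_n\mid\exists\,\sigma\in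 H^0(X,E/\mathrm{B}),\ \varphi\in H^0(X,E_\sigma(\mathfrak{b})\otimes K)\},$$ where $E_\sigma=\sigma^*E$ is the principal $\mathrm{B}$-bundle associated to the section $\sigma$; equivalently, $E$ admits a full flag of $\varphi$-invariant holomorphic subbundles. *)

(* Defs.v *)
From HB Require Import structures.
From mathcomp Require Import all_boot all_order all_algebra.
From mathcomp Require Import complex.
From mathcomp Require Import (canonicals, coercions) mpoly.
From mathcomp Require Import boolp classical_sets functions fsbigop reals.

Set Implicit Arguments.
Unset Strict Implicit.
Unset Printing Implicit Defensive.

Import GRing.Theory Num.Theory.
Local Open Scope classical_set_scope.
Local Open Scope ring_scope.

Local Notation "{ 'mpoly' T [ n ] }" := (mpoly.mpoly n T).
Local Notation "d .-homog" := (mpoly.ishomog1 d mpoly.mdeg)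
  (at level 1, format "d .-homog") : form_scope.

Definition alg_indep (S F : fieldType) (c : {rmorphism S -> F}) k
    (f : 'I_k -> F) : Prop :=
  forall P : {mpoly S[k]}, mpoly.mmap c f P = 0 -> P = 0.

(* An integral closed subscheme of [P^N] over the complex numbers is the
   closure of its generic point. It is given here by that point: its residue
   field [fun_field], which is the function field of the subscheme, and its
   homogeneous coordinates [gen]. Every rational function is [P(gen)/Q(gen)]
   for homogeneous [P], [Q] of the same degree. The subscheme is a curve when
   [fun_field] has transcendence degree 1. *)
Record curve (R : realType) := Curve {
  pdim : nat;
  fun_field : fieldType;
  constants : {rmorphism R[i] -> fun_field};
  gen : 'I_pdim.+1 -> fun_field;
  gen_neq0 : exists i, gen i != 0;
  gen_fun_field : forall f : fun_field, exists d (P Q : {mpoly R[i][pdim.+1]}),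
    [/\ P \is d.-homog, Q \is d.-homog, mpoly.mmap constants gen Q != 0 &
        f = mpoly.mmap constants gen P / mpoly.mmap constants gen Q];
  trdeg_ge1 : exists f : 'I_1 -> fun_field, alg_indep constants f;
  trdeg_le1 : forall f : 'I_2 -> fun_field, ~ alg_indep constants f
}.

Section Curve.
Variables (R : realType) (X : curve R).
Local Notation F := (fun_field X).
Local Notation form := {mpoly R[i][(pdim X).+1]}.
Implicit Types (P Q : form).

Definition at_gen P : F := mpoly.mmap (constants X) (@gen R X) P.

(* A point of projective space is a line through the origin; [vpick l] is a
   vector spanning [l], that is, a choice of homogeneous coordinates. Only the
   vanishing of homogeneous [P] is used below, and it does not depend on this
   choice. *)
Definition at_line P (l : {vspace 'rV[R[i]]_(pdim X).+1}) : R[i] :=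
  mpoly.meval (vpick l ord0) P.

Definition locus : set {vspace 'rV[R[i]]_(pdim X).+1} :=
  [set l | \dim l = 1%N /\
    forall d P, P \is d.-homog -> at_gen P = 0 -> at_line P l = 0].

Definition point := set_type locus.
HB.instance Definition _ := Choice.on point.

Definition zariski_open (U : set point) : Prop :=
  forall x, U x -> exists d Q, [/\ Q \is d.-homog, at_line Q (val x) != 0 &
    forall y : point, at_line Q (val y) != 0 -> U y].

Definition loc_ring (x : point) : {pred F} := fun f =>
  `[< exists d P Q, [/\ P \is d.-homog, Q \is d.-homog,
        at_line Q (val x) != 0 & f = at_gen P / at_gen Q] >].

Definition max_ideal (x : point) : set F := [set f |
  exists d P Q, [/\ P \is d.-homog, Q \is d.-homog, at_line P (val x) = 0,
    at_line Q (val x) != 0 & f = at_gen P / at_gen Q]].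

Definition uniformizer (x : point) (t : F) : Prop :=
  max_ideal x = [set t * f | f in [set f | f \in loc_ring x]].

(* The local rings have dimension 1, so this says that they are regular. *)
Definition smooth : Prop := forall x, exists t, uniformizer x t.

Lemma at_gen_neq0 (x : point) Q d :
  Q \is d.-homog -> at_line Q (val x) != 0 -> at_gen Q != 0.
Proof.
move=> hQ nQ; apply/negP => /eqP Q0; move/eqP: nQ; apply.
by have [_ /(_ d Q hQ Q0)] := set_mem (valP x).
Qed.

Lemma at_genM P Q : at_gen (P * Q) = at_gen P * at_gen Q.
Proof. exact: rmorphM. Qed.

Lemma at_lineM P Q l : at_line (P * Q) l = at_line P l * at_line Q l.
Proof. exact: rmorphM. Qed.

Lemma loc_ring_subring_closed (x : point) : GRing.subring_closed (loc_ring x).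
Proof.
split.
- apply/asboolP; exists 0%N, 1, 1; rewrite /at_gen /at_line mpoly.dhomog1.
  by rewrite !rmorph1 divr1 oner_neq0.
- move=> f g /asboolP[d [P [Q [hP hQ nQ ->]]]].
  move=> /asboolP[e [P' [Q' [hP' hQ' nQ' ->]]]].
  apply/asboolP; exists (d + e)%N, (P * Q' - P' * Q), (Q * Q'); split.
  + by apply: rpredB; [|rewrite addnC]; exact: mpoly.dhomogM.
  + exact: mpoly.dhomogM.
  + by rewrite at_lineM mulf_neq0.
  + rewrite -mulNr addf_div ?(at_gen_neq0 hQ nQ) ?(at_gen_neq0 hQ' nQ') //.
    rewrite mulNr at_genM; congr (_ / _).
    by rewrite -!at_genM /at_gen rmorphB.
- move=> f g /asboolP[d [P [Q [hP hQ nQ ->]]]].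
  move=> /asboolP[e [P' [Q' [hP' hQ' nQ' ->]]]].
  apply/asboolP; exists (d + e)%N, (P * P'), (Q * Q'); split.
  + exact: mpoly.dhomogM.
  + exact: mpoly.dhomogM.
  + by rewrite at_lineM mulf_neq0.
  + by rewrite !at_genM mulf_div.
Qed.

HB.instance Definition _ x :=
  GRing.isSubringClosed.Build F (loc_ring x) (loc_ring_subring_closed x).

Definition ord (x : point) (f : F) : int := xget 0 [set k : int |
  exists t u, [/\ uniformizer x t, u \in loc_ring x, u^-1 \in loc_ring x,
                  u != 0 & f = t ^ k * u]].

Definition is_der : {pred F -> F^o} := fun D =>
  `[< [/\ forall c, D (constants X c) = 0, forall f g, D (f + g) = D f + D g &
          forall f g, D (f * g) = f * D g + g * D f] >].

Lemma is_der_submod_closed : submod_closed is_der.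
Proof.
split.
- by apply/asboolP; split=> *; rewrite ?addr0 ?mulr0 ?addr0.
- move=> a D E /asboolP[Dc DD DM] /asboolP[Ec ED EM]; apply/asboolP.
  rewrite /GRing.add /= /GRing.scale /=.
  split=> [c|f g|f g]; rewrite ?Dc ?Ec ?DD ?ED ?DM ?EM /GRing.scale /=.
  + by rewrite mulr0 addr0.
  + by rewrite mulrDr addrACA.
  + rewrite !mulrDr addrACA; congr (_ + _); congr (_ + _); exact: mulrCA.
Qed.

HB.instance Definition _ :=
  GRing.isSubmodClosed.Build F (F -> F^o) is_der is_der_submod_closed.

(* The rational vector fields of [X]: the generic stalk of its tangent sheaf. *)
Record der := Der { der_fun :> F -> F^o; _ : der_fun \in is_der }.

HB.instance Definition _ := [isSub for der_fun].
HB.instance Definition _ := [Choice of der by <:].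
HB.instance Definition _ := [SubChoice_isSubLmodule of der by <:].

(* The stalk at [x] of the tangent sheaf. *)
Definition tangent (x : point) (D : der) : Prop :=
  forall f, f \in loc_ring x -> D f \in loc_ring x.

(* [H^0(X, K^i)] for [i > 0]. The canonical bundle [K] is the dual of the
   tangent line bundle, so a section of [K^i] is an [i]-homogeneous map from
   the tangent bundle to the structure sheaf: [f (dt)^i] is the map
   [D |-> f (D t)^i]. Vector fields are one-dimensional over the function
   field, so that homogeneity implies additivity for [i = 1]. *)
Record pluricanonical (i : nat) := Pluricanonical {
  pluri :> der -> F;
  pluri_homog : forall (f : F) D, pluri (f *: D) = f ^+ i * pluri D;
  pluri_regular : forall x D, tangent x D -> pluri D \in loc_ring x
}.

(* The [O_x]-submodule of [F^m] generated by the rows of [e]. *)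
Definition mx_span k m (x : point) (e : 'M[F]_(k, m)) : set 'rV[F]_m :=
  [set c *m e | c in [set c : 'rV[F]_k | c \is a mxOver (loc_ring x)]].

Definition frame_on k m (U : set point) (L : point -> set 'rV[F]_m)
    (e : 'M[F]_(k, m)) : Prop :=
  row_free e /\ forall x, U x -> L x = mx_span x e.

(* A vector bundle of rank [k], seen as a locally free sheaf. Such a
   sheaf embeds in the constant sheaf of its generic stalk, here a
   [k]-dimensional subspace of [F^m]; [stalk] gives the stalks, and the
   sections over [U] are the vectors that lie in the stalks at all points of
   [U]. Any rank [k] bundle is a [bundle k k]; taking [m > k] allows for the
   subbundles of a given bundle. *)
Record bundle (m k : nat) := Bundle {
  stalk :> point -> set 'rV[F]_m;
  locally_free : forall x, exists U (e : 'M[F]_(k, m)),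
    [/\ U x, zariski_open U & frame_on U stalk e]
}.

Definition subbundle m l k (S : bundle m l) (L : bundle m k) : Prop :=
  forall x, exists U p (e1 : 'M[F]_(l, m)) (e2 : 'M[F]_(p, m)),
    [/\ U x, zariski_open U, frame_on U S e1 & frame_on U L (col_mx e1 e2)].

(* The degree of the divisor of a rational section of the determinant of [L].
   The rows of [B] are a rational frame of [L] and those of [A x *m B] a frame
   of the stalk at [x], so the determinant of [B] is a rational section whose
   order at [x] is that of [(\det (A x))^-1]. *)
Definition degree m k (L : bundle m k) : int := xget 0 [set d : int |
  exists (B : 'M[F]_(k, m)) (A : point -> 'M[F]_k),
    [/\ row_free B,
        forall x, A x \in unitmx /\ L x = mx_span x (A x *m B) &
        d = - \sum_(x \in [set: point]) ord x (\det (A x))]].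

Definition slope m k (L : bundle m k) : rat := (degree L)%:~R / k%:R.

(* A rational section of [End(E) * K] is a linear map from vector fields to
   endomorphisms of the generic stalk; matrices act on row vectors. *)
Record higgs (n : nat) := Higgs {
  vbundle : bundle n n;
  phi : {linear der -> 'M[F]_n};
  phi_regular : forall x D v,
    tangent x D -> vbundle x v -> vbundle x (v *m phi D)
}.

Section Higgs.
Variable n : nat.
Implicit Types E : higgs n.

Definition invariant E k (S : bundle n k) : Prop := forall x D v,
  tangent x D -> S x v -> S x (v *m phi E D).

(* Stability of an invariant subbundle with the induced Higgs field. *)
Definition stable E k (S : bundle n k) : Prop := (0 < k)%N /\
  forall l (T : bundle n l), (0 < l < k)%N -> subbundle T S -> invariant E T ->
    slope T < slope S.

Definition direct_sum m k (L : bundle m k) r (d : 'I_r -> nat)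
    (S : forall j, bundle m (d j)) : Prop :=
  forall x,
    (forall v, L x v <-> exists s : 'I_r -> 'rV[F]_m,
        (forall j, S j x (s j)) /\ v = \sum_j s j) /\
    (forall s : 'I_r -> 'rV[F]_m, (forall j, S j x (s j)) ->
        \sum_j s j = 0 -> forall j, s j = 0).

Definition polystable E : Prop :=
  exists r (d : 'I_r -> nat) (S : forall j, bundle n (d j)),
    direct_sum (vbundle E) S /\
    forall j, [/\ invariant E (S j), stable E (S j) &
                  slope (S j) = slope (vbundle E)].

Definition higgs_iso E E' : Prop := exists2 g : 'M[F]_n, g \in unitmx &
  (forall x, vbundle E' x = [set v *m g | v in vbundle E x]) /\
  (forall D, g *m phi E' D = phi E D *m g).

(* The points of the moduli space of semistable Higgs bundles of rank [n] and
   degree 0. *)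
Definition moduli : Type := set_type [set c : set (higgs n) |
  exists E, [/\ polystable E, degree (vbundle E) = 0 & c = higgs_iso E]].

(* [q_(i+1)] is the coefficient of degree [n - (i+1)] of the characteristic
   polynomial [det('X - A)]. *)
Definition char_coef (i : 'I_n) (A : 'M[F]_n) : F :=
  (char_poly A)`_(n - i.+1)%N.

Definition hitchin_base : Type := forall i : 'I_n, pluricanonical i.+1.

Lemma char_coefZ i (a : F) (A : 'M[F]_n) :
  char_coef i (a *: A) = a ^+ i.+1 * char_coef i A.
Proof.
rewrite /char_coef; have [->|a0] := eqVneq a 0.
  rewrite scale0r expr0n /= mulr0n mul0r /char_poly /char_poly_mx map_mx0 subr0.
  by rewrite det_scalar coefXn ltn_eqF // subnS prednK ?leq_subr // subn_gt0.
have coef_scale (p : {poly F}) k : (p \Po (a *: 'X))`_k = a ^+ k * p`_k.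
  rewrite comp_polyE.
  under eq_bigr do rewrite exprZn scalerA.
  rewrite -(poly_def _ (fun j => p`_j * a ^+ j)) coef_poly.
  by case: ltnP => [_|/(nth_default 0) ->]; [exact: mulrC|rewrite mulr0].
have : char_poly (a *: A) \Po (a *: 'X) = a ^+ n *: char_poly A.
  rewrite /char_poly -[LHS](det_map_mx (comp_poly (a *: 'X))) /=.
  rewrite -[RHS]mul_polyC rmorphXn /= -detZ; congr (\det _).
  apply/matrixP => j k; rewrite !mxE /= rmorphB /= rmorphMn /= comp_polyX.
  by rewrite comp_polyC mulrBr mulrnAr mul_polyC polyCM.
move=> /(congr1 (fun p : {poly F} => p`_(n - i.+1)%N)).
rewrite coef_scale coefZ => /(canRL (mulKf (expf_neq0 _ a0))) ->.
have -> : a ^+ n = a ^+ (n - i.+1) * a ^+ i.+1 by rewrite -exprD subnK.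
by rewrite -mulrA mulKf // expf_neq0.
Qed.

Lemma char_coef_over (x : point) i (e A : 'M[F]_n) : e \in unitmx ->
  e *m A *m invmx e \is a mxOver (loc_ring x) -> char_coef i A \in loc_ring x.
Proof.
move=> eU eA; suff : char_poly A \is a polyOver (loc_ring x) by move/polyOverP; apply.
have -> : char_poly A = char_poly (e *m A *m invmx e).
  pose E := map_mx polyC e; pose E' := map_mx polyC (invmx e).
  have EE' : E *m E' = 1%:M by rewrite -map_mxM mulmxV // map_mx1.
  rewrite /char_poly; have -> : char_poly_mx (e *m A *m invmx e) =
      E *m char_poly_mx A *m E'.
    rewrite /char_poly_mx !map_mxM mulmxBr mulmxBl; congr (_ - _).
    by rewrite scalar_mxC -mulmxA EE' mulmx1.
  by rewrite !det_mulmx mulrAC -det_mulmx EE' det1 mul1r.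
move: (e *m A *m invmx e) eA => B /mxOverP oB.
apply: rpred_sum => s _; apply: rpredM; first exact: rpred_sign.
apply: rpred_prod => j _; rewrite !mxE rpredB ?polyOverC ?oB //.
by rewrite rpredMn ?polyOverX.
Qed.

Section CharCoefs.
Variable A : der -> 'M[F]_n.
Hypothesis homogA : forall (f : F) D, A (f *: D) = f *: A D.
Hypothesis regA : forall x, exists2 e : 'M[F]_n, e \in unitmx &
  forall D, tangent x D -> e *m A D *m invmx e \is a mxOver (loc_ring x).

Lemma char_coefs_homog i (f : F) D :
  char_coef i (A (f *: D)) = f ^+ i.+1 * char_coef i (A D).
Proof. by rewrite homogA char_coefZ. Qed.

Lemma char_coefs_regular i x D :
  tangent x D -> char_coef i (A D) \in loc_ring x.
Proof. by have [e eU eA] := regA x => /eA; exact: char_coef_over. Qed.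

Definition char_coefs : hitchin_base :=
  fun i => Pluricanonical (@char_coefs_homog i) (@char_coefs_regular i).

End CharCoefs.

Lemma phi_homog E f D : phi E (f *: D) = f *: phi E D.
Proof. exact: linearZ. Qed.

Lemma phi_frame E x : exists2 e : 'M[F]_n, e \in unitmx &
  forall D, tangent x D -> e *m phi E D *m invmx e \is a mxOver (loc_ring x).
Proof.
have [U [e [Ux _ [fe Le]]]] := locally_free (vbundle E) x.
have eU : e \in unitmx by rewrite -row_free_unit.
exists e => // D tD; apply/mxOverP => i j.
have ei : vbundle E x (row i e).
  rewrite Le //; exists (row i 1%:M); last by rewrite -row_mul mul1mx.
  by apply/mxOverP => ? k; rewrite !mxE; case: eqP => _; rewrite ?rpred1 ?rpred0.
have := phi_regular tD ei; rewrite Le // => -[c /mxOverP oc ce].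
have -> : (e *m phi E D *m invmx e) i j = c 0 j; last exact: oc.
have -> : c = row i (e *m phi E D *m invmx e).
  by rewrite !row_mul -ce -mulmxA mulmxV // mulmx1.
by rewrite [RHS]mxE.
Qed.

Definition hitchin_higgs E : hitchin_base :=
  char_coefs (@phi_homog E) (@phi_frame E).

(* The Higgs bundles in a class have the same image, so the choice of a
   representative is immaterial. *)
Definition hitchin (c : moduli) : hitchin_base :=
  hitchin_higgs (projT1 (cid (set_mem (valP c)))).

Definition diag_field (alpha : 'I_n -> pluricanonical 1) (D : der) : 'M[F]_n :=
  diag_mx (\row_i alpha i D).

Lemma diag_field_homog alpha f D :
  diag_field alpha (f *: D) = f *: diag_field alpha D.
Proof.
apply/matrixP => i j; rewrite !mxE pluri_homog expr1.
by case: eqP; rewrite ?mulr1n ?mulr0n ?mulr0.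
Qed.

Lemma diag_field_regular alpha x : exists2 e : 'M[F]_n, e \in unitmx &
  forall D, tangent x D ->
    e *m diag_field alpha D *m invmx e \is a mxOver (loc_ring x).
Proof.
exists 1%:M => [|D tD]; first exact: unitmx1.
rewrite mul1mx invmx1 mulmx1; apply: mxOver_diag; first exact: rpred0.
by apply/mxOverP => i j; rewrite mxE pluri_regular.
Qed.

(* The map is invariant under permutations and injective on orbits: its image
   is the symmetric power of [H^0(X, K)] embedded in the Hitchin base. *)
Definition diag_hitchin (alpha : 'I_n -> pluricanonical 1) : hitchin_base :=
  char_coefs (@diag_field_homog alpha) (@diag_field_regular alpha).

Definition sym_locus : set hitchin_base := range diag_hitchin.

(* The Borel subgroups of [GL_n(C)] are the conjugates [g^-1 T g] of the group
   [T] of lower triangular matrices, and the Lie algebra of [g^-1 T g] is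
   [g^-1 t g] with [t] the lower triangular matrices. The condition below is
   membership in that Lie algebra with scalars extended to [F], or in the Borel
   subgroup when [A] is invertible. *)
Definition in_borel (g : 'M[R[i]]_n) (A : 'M[F]_n) : Prop :=
  let gF := map_mx (constants X) g in is_trig_mx (gF *m A *m invmx gF).

(* A section of [E / B] is given by local frames of [E] whose transition
   matrices lie in [B]; a Higgs field lies in [E_sigma(b) * K] when its matrices
   in these frames lie in [b]. A change of frame [e] to [b *m e] is the action
   of [b] on the frame bundle. *)
Definition borel_reduction (g : 'M[R[i]]_n) E : Prop :=
  exists (U : point -> set point) (e : point -> 'M[F]_n),
    [/\ forall x, [/\ U x x, zariski_open (U x) &
                       frame_on (U x) (vbundle E) (e x)],
        forall x y, in_borel g (e x *m invmx (e y)) &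
        forall x D, in_borel g (e x *m phi E D *m invmx (e x))].

Definition bor (g : 'M[R[i]]_n) : set moduli :=
  [set c | exists2 E, val c E & borel_reduction g E].

End Higgs.

End Curve.

(* Main.v *)
From HB Require Import structures.
From mathcomp Require Import all_boot all_order fingroup perm all_algebra.
From mathcomp Require Import complex ring.
From mathcomp Require Import (canonicals, coercions) mpoly.
From mathcomp Require Import boolp classical_sets reals.
Require Import Defs.

(** If the spectral curve splits, the characteristic polynomial of the Higgs
    field at the generic point is a product of linear factors. The rational
    vector fields form a line over the function field F, so one flag of F^n is
    invariant under the Higgs field in all directions. Since X is smooth, its
    local rings are valuation rings, and the Iwasawa decomposition
    GL_n(F) = B(F) GL_n(O_x) turns every local frame of E into one adapted to
    the generic flag; this is the valuative criterion for the flag bundle E/B.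

    Conversely, the diagonal entries of a Higgs field written in frames adapted
    to a flag do not depend on the frame, so they glue to global one-forms. This
    direction needs a point of X, since a reduction is given by its frames at
    the points. A point is the centre of a place of F with values in the
    complex numbers, and such a place is a maximal homomorphism from a subring
    of F to the complex numbers. *)

Set Implicit Arguments.
Unset Strict Implicit.
Unset Printing Implicit Defensive.

Import GRing.Theory Num.Theory.
Local Open Scope classical_set_scope.
Local Open Scope ring_scope.

Local Notation "{ 'mpoly' T [ n ] }" := (mpoly.mpoly n T).
Local Notation "d .-homog" := (mpoly.ishomog1 d mpoly.mdeg)
  (at level 1, format "d .-homog") : form_scope.

(** * Triangular matrices and valuation rings *)

Section TriangularMatrices.
Variable K : fieldType.

Lemma trig_mulmx n (A B : 'M[K]_n) :
  is_trig_mx A -> is_trig_mx B -> is_trig_mx (A *m B).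
Proof.
move=> /is_trig_mxP tA /is_trig_mxP tB; apply/is_trig_mxP => i j lij.
rewrite mxE big1 // => k _; case: (ltnP i k) => [/tA->|lki].
  by rewrite mul0r.
by rewrite (tB k j) ?mulr0 // (leq_ltn_trans lki).
Qed.

Lemma trig_mulmx_diag n (A B : 'M[K]_n) i :
  is_trig_mx A -> is_trig_mx B -> (A *m B) i i = A i i * B i i.
Proof.
move=> /is_trig_mxP tA /is_trig_mxP tB.
rewrite mxE (bigD1 i) //= big1 ?addr0 // => k; rewrite neq_ltn.
by case/orP => lt; [rewrite (tB k i) ?mulr0|rewrite (tA i k) ?mul0r].
Qed.

Lemma trig_unitmx_diag_neq0 n (A : 'M[K]_n) i :
  is_trig_mx A -> A \in unitmx -> A i i != 0.
Proof.
by move=> tA; rewrite unitmxE det_trig // unitfE => /prodf_neq0; apply.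
Qed.

Lemma trig_invmx n (A : 'M[K]_n) :
  is_trig_mx A -> A \in unitmx -> is_trig_mx (invmx A).
Proof.
move=> tA uA; apply/is_trig_mxP => i j lij.
(* Columns are treated from right to left: once the entries of row [i] to the right of column [j]
   vanish, the entry [(i, j)] of [invmx A *m A] is a single product with the nonzero factor
   [A j j]. *)
have [m] := ubnP (n - j); elim: m j lij => // m IH j lij ljm.
have := mulVmx uA => /matrixP /(_ i j); rewrite !mxE -val_eqE /= ltn_eqF //.
rewrite (bigD1 j) //= big1 ?addr0 => [/eqP|k].
  by rewrite mulf_eq0 (negbTE (trig_unitmx_diag_neq0 j tA uA)) orbF => /eqP.
rewrite neq_ltn => /orP[lkj|ljk]; first by rewrite (is_trig_mxP tA) ?mulr0.
rewrite IH ?mul0r ?(ltn_trans lij) //; rewrite -ltnS; apply: leq_trans ljm.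
by rewrite ltnS ltn_sub2l // (ltn_trans ljk).
Qed.

Lemma trig_block_mx n1 n2 (A : 'M[K]_n1) (B : 'M[K]_(n2, n1)) (C : 'M[K]_n2) :
  is_trig_mx A -> is_trig_mx C -> is_trig_mx (block_mx A 0 B C).
Proof.
move=> /is_trig_mxP tA /is_trig_mxP tC; apply/is_trig_mxP => i j.
case: (split_ordP i) => i' ->; case: (split_ordP j) => j' -> /= lij.
- by rewrite block_mxEul tA.
- by rewrite block_mxEur mxE.
- by have := ltn_ord j'; rewrite ltnNge ltnW // (leq_ltn_trans _ lij) ?leq_addr.
- by rewrite block_mxEdr tC // -(ltn_add2l n1).
Qed.

Lemma invmx_mul n (A B : 'M[K]_n) : A \in unitmx -> B \in unitmx ->
  invmx (A *m B) = invmx B *m invmx A.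
Proof.
move=> uA uB; have uAB : A *m B \in unitmx by rewrite unitmx_mul uA.
apply: (can_inj (mulmxK uAB)); rewrite mulVmx // mulmxA -[_ *m A]mulmxA.
by rewrite mulVmx // mulmx1 mulVmx.
Qed.

Lemma char_poly_conj n (b A : 'M[K]_n) : b \in unitmx ->
  char_poly (b *m A *m invmx b) = char_poly A.
Proof.
move=> ub; pose E := map_mx polyC b; pose E' := map_mx polyC (invmx b).
have EE' : E *m E' = 1%:M by rewrite -map_mxM mulmxV // map_mx1.
have -> : char_poly (b *m A *m invmx b) = \det (E *m char_poly_mx A *m E').
  congr (\det _); rewrite /char_poly_mx !map_mxM mulmxBr mulmxBl.
  by rewrite scalar_mxC -[_ *m E *m E']mulmxA EE' mulmx1.
by rewrite !det_mulmx mulrAC -det_mulmx EE' det1 mul1r.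
Qed.

Lemma char_poly_lblock n1 n2 (A : 'M[K]_n1) (B : 'M[K]_(n2, n1))
    (C : 'M[K]_n2) :
  char_poly (block_mx A 0 B C) = char_poly A * char_poly C.
Proof.
rewrite /char_poly -(det_lblock _ (- map_mx polyC B)); congr (\det _).
rewrite /char_poly_mx map_block_mx map_mx0 (scalar_mx_block n1 n2).
by rewrite opp_block_mx add_block_mx !(oppr0, addr0, add0r).
Qed.

Lemma lblock_row0 n (A : 'M[K]_(1 + n)) a :
  (forall j, A 0 j = a *+ (j == 0)) ->
  A = block_mx a%:M 0 (dlsubmx A) (drsubmx A).
Proof.
move=> A0; rewrite -{1}[A]submxK.
congr (block_mx _ _ _ _); apply/matrixP => i j.
- rewrite [LHS]mxE [LHS]mxE !ord1 !mxE /=.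
  have -> : lshift n (0 : 'I_1) = 0 by exact: val_inj.
  by rewrite A0 eqxx.
- rewrite [LHS]mxE [LHS]mxE ord1 !mxE.
  have -> : lshift n (0 : 'I_1) = 0 by exact: val_inj.
  by rewrite A0.
Qed.

(** Matrices act on row vectors, so an eigenvector taken as first basis vector makes the first row
    [a, 0, ..., 0]. The factor ['X - a%:P] then cancels and the lower right block is treated by
    induction. *)
Lemma trigonalize n (A : 'M[K]_n) (s : seq K) :
  char_poly A = \prod_(a <- s) ('X - a%:P) ->
  exists2 b, b \in unitmx & is_trig_mx (b *m A *m invmx b).
Proof.
elim: n A s => [|n IH] A s cA.
  by exists 1%:M; rewrite ?unitmx1 //; apply/is_trig_mxP => -[].
case: s cA => [|a s] cA.
  by move: (size_char_poly A); rewrite cA big_nil size_poly1.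
have [|v vA v0] := @eigenvalueP K n.+1 A a _.
  by rewrite eigenvalue_root_char cA big_cons rootM root_XsubC eqxx.
(* As [v] has rank 1, it is a scalar multiple of the first row of [row_ebase v]; this completes the
   eigenvector to a basis. *)
pose b := row_ebase v; have ub : b \in unitmx by exact: row_ebase_unit.
have rv : \rank v = 1%N by apply/eqP; rewrite rank_rV v0.
pose c := (col_ebase v) 0 0.
have vE : v = c *: row (0 : 'I_(1 + n)) b.
  rewrite -{1}(mulmx_ebase v) rv [col_ebase v]mx11_scalar mul_scalar_mx.
  rewrite -scalemxAl.
  congr (_ *: _); rewrite rowE; congr (_ *m _).
  by apply/rowP => j; rewrite !mxE /= andbT eq_sym.
have c0 : c != 0 by apply: contraNneq v0 => c0; rewrite vE c0 scale0r.
have bA : row (0 : 'I_(1 + n)) b *m A = a *: row (0 : 'I_(1 + n)) b.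
  apply: (scalerI c0); rewrite scalemxAl -vE vA vE scalerA scalerA.
  by rewrite mulrC.
pose A' : 'M_(1 + n) := b *m A *m invmx b.
have A'0 j : A' 0 j = a *+ (j == 0).
  have -> : A' 0 j = row 0 A' 0 j by rewrite [RHS]mxE.
  rewrite /A' !row_mul bA -scalemxAl -row_mul mulmxV // !mxE eq_sym.
  by rewrite mulr_natr.
have A'E := lblock_row0 A'0.
have [|b' ub' tb'] := IH (drsubmx A') s.
  have := char_poly_lblock a%:M (dlsubmx A') (drsubmx A').
  rewrite -A'E (char_poly_conj A ub : char_poly A' = _) cA big_cons.
  have -> : char_poly (a%:M : 'M_1) = 'X - a%:P.
    by rewrite char_poly_trig ?scalar_mx_is_trig // big_ord1 !mxE.
  by move=> /(mulfI _) ->; rewrite ?polyXsubC_eq0.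
pose B : 'M_(1 + n) := block_mx 1%:M 0 0 b'.
have uB : B \in unitmx by rewrite unitmxE det_lblock det1 mul1r.
exists (B *m b); first by rewrite unitmx_mul uB.
have -> : B *m b *m A *m invmx (B *m b) = B *m A' *m invmx B.
  by rewrite /A' invmx_mul // !mulmxA.
rewrite /B invmx_block_diag // A'E !mulmx_block.
rewrite !(mul0mx, mulmx0, mul1mx, addr0, add0r).
by rewrite invmx1 mulmx1 (@trig_block_mx 1 n) ?scalar_mx_is_trig.
Qed.
End TriangularMatrices.

(** * Iwasawa decomposition over a valuation ring *)

Section ValuationRing.
Variables (K : fieldType) (S : subringClosed K).
Hypothesis valS : forall f : K, f \in S \/ f^-1 \in S.

(** Divisibility is a total preorder in a valuation ring, so a finite family has a least element. *)
Lemma exists_divisor_of_all n (v : 'I_n.+1 -> K) :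
  exists i, forall j, exists2 c, c \in S & v j = c * v i.
Proof.
elim: n v => [|n IH] v.
  by exists 0 => j; exists 1; rewrite ?rpred1 // mul1r ord1.
have [i Hi] := IH (fun j => v (lift 0 j)).
have [c0i|] : (exists2 c, c \in S & v 0 = c * v (lift 0 i)) \/
    (exists2 c, c \in S & v (lift 0 i) = c * v 0).
- have [->|vi0] := eqVneq (v (lift 0 i)) 0.
    by right; exists 0; rewrite ?rpred0 // mul0r.
  have [v00|v00] := eqVneq (v 0) 0.
    by left; exists 0; rewrite ?rpred0 // v00 mul0r.
  have [cS|cS] := valS (v 0 / v (lift 0 i)).
    by left; exists (v 0 / v (lift 0 i)) => //; rewrite divfK.
  by right; exists (v (lift 0 i) / v 0); rewrite ?divfK // -invf_div.
- by exists (lift 0 i) => j; case: (unliftP 0 j) => [k|] ->.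
- move=> [c cS ci]; exists 0 => j; case: (unliftP 0 j) => [k|] ->.
    have [d dS ->] := Hi k; rewrite ci mulrA; exists (d * c) => //.
    exact: rpredM.
  by exists 1; rewrite ?rpred1 // mul1r.
Qed.

Definition GLover n (k : 'M[K]_n) : Prop :=
  [/\ k \in unitmx, k \is a mxOver S & invmx k \is a mxOver S].

Lemma GLoverI n (k l : 'M[K]_n) : k \is a mxOver S -> l \is a mxOver S ->
  k *m l = 1%:M -> GLover k.
Proof.
move=> ok ol kl; have [uk _] := mulmx1_unit kl.
by split; rewrite // -[invmx k]mulmx1 -kl mulKmx.
Qed.

Lemma GLoverM n (k l : 'M[K]_n) : GLover k -> GLover l -> GLover (k *m l).
Proof.
move=> [uk ok ok'] [ul ol ol']; split; first by rewrite unitmx_mul uk.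
  exact: mxOverM.
by rewrite invmx_mul //; exact: mxOverM.
Qed.

Lemma mxOver1 n : (1%:M : 'M[K]_n) \is a mxOver S.
Proof. by apply: mxOver_scalar; rewrite ?rpred0 ?rpred1. Qed.

Lemma GLoverV n (k : 'M[K]_n) : GLover k -> GLover (invmx k).
Proof. by move=> [uk ok ok']; split; rewrite ?invmxK // unitmx_inv. Qed.

Lemma GLover1 n : GLover (1%:M : 'M[K]_n).
Proof. by split; rewrite ?invmx1 ?unitmx1 ?mxOver1. Qed.

Lemma GLover_perm n (s : 'S_n) : GLover (perm_mx s).
Proof.
have op (t : 'S_n) : (perm_mx t : 'M[K]_n) \is a mxOver S.
  by apply/mxOverP => i j; rewrite !mxE; case: eqP => _; rewrite ?rpred0 ?rpred1.
by apply: (GLoverI (op s) (op s^-1%g)); rewrite -perm_mxM mulgV perm_mx1.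
Qed.

Lemma mxOver_block m1 m2 n1 n2 (A : 'M[K]_(m1, n1)) (B : 'M[K]_(m1, n2))
    (C : 'M[K]_(m2, n1)) (D : 'M[K]_(m2, n2)) :
  A \is a mxOver S -> B \is a mxOver S ->
  C \is a mxOver S -> D \is a mxOver S ->
  block_mx A B C D \is a mxOver S.
Proof.
move=> /mxOverP oA /mxOverP oB /mxOverP oC /mxOverP oD; apply/mxOverP => i j.
by case: (split_ordP i) => i' ->; case: (split_ordP j) => j' ->;
  rewrite ?block_mxEul ?block_mxEur ?block_mxEdl ?block_mxEdr.
Qed.

(** An entry that divides all others is moved to the front; the others are then cleared by column
    operations with coefficients in [S]. *)
Lemma row_reduction n (v : 'rV[K]_(1 + n)) :
  exists2 k, GLover k & exists a, forall j, (v *m k) 0 j = a *+ (j == 0).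
Proof.
have [i Hi] := exists_divisor_of_all (v 0).
pose p : 'M[K]_(1 + n) := tperm_mx 0 i.
have Gp : GLover p by exact: GLover_perm.
pose w : 'rV_(1 + n) := v *m p.
have wE j : w 0 j = v 0 (tperm 0 i j) by rewrite /w -xcolE mxE.
have /fin_all_exists2[c cS cE] j :
    exists2 c, c \in S & w 0 (rshift 1 j) = c * w 0 0.
  by rewrite !wE tpermL.
pose k : 'M[K]_(1 + n) := block_mx 1%:M (- \row_j c j) 0 1%:M.
pose k' : 'M[K]_(1 + n) := block_mx 1%:M (\row_j c j) 0 1%:M.
have kk' : k *m k' = 1%:M.
  rewrite mulmx_block !(mul1mx, mulmx1, mul0mx, mulmx0, addr0, add0r) addrN.
  by rewrite -scalar_mx_block.
have oc : \row_j c j \is a mxOver S by apply/mxOverP => ? j; rewrite mxE.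
exists (p *m k).
  apply: (GLoverM Gp); apply: GLoverI kk'.
    by rewrite mxOver_block ?mxOver1 ?rpredN // mxOver0 ?rpred0.
  by rewrite mxOver_block ?mxOver1 // mxOver0 ?rpred0.
exists (w 0 0) => j; rewrite mulmxA -/w.
have wB : w = row_mx (w 0 0)%:M (\row_j (c j * w 0 0)).
  rewrite -[LHS]hsubmxK; congr (row_mx _ _); apply/rowP => l;
    rewrite [LHS]mxE [RHS]mxE.
    by rewrite !ord1 eqxx mulr1n; congr (w 0 _); exact: val_inj.
  by rewrite cE.
move: (w 0 0) wB => a ->.
rewrite mul_row_block !(mul1mx, mulmx1, mul0mx, mulmx0, addr0, add0r).
case: (split_ordP j) => j' ->.
  by rewrite row_mxEl !mxE !ord1 eqxx.
rewrite row_mxEr !mxE big_ord1 !mxE eqxx mulr1n.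
by rewrite mulrN mulrC addNr.
Qed.

(** This is the Iwasawa decomposition: an invertible [N] is a triangular matrix times an element of
    GL_n(S). The rows are reduced one after the other, from the top. *)
Lemma column_reduction n (N : 'M[K]_n) :
  exists2 k, GLover k & is_trig_mx (N *m k).
Proof.
elim: n N => [|n IH] N.
  by exists 1%:M; [exact: GLover1|apply/is_trig_mxP => -[]].
have [k1 Gk1 [a aE]] := row_reduction (row 0 N : 'rV_(1 + n)).
pose N1 : 'M_(1 + n) := N *m k1.
have N1E : N1 = block_mx a%:M 0 (dlsubmx N1) (drsubmx N1).
  by apply: lblock_row0 => j; rewrite -aE -row_mul [RHS]mxE.
have [k2 [u2 o2 o2'] tk2] := IH (drsubmx N1).
pose B : 'M_(1 + n) := block_mx 1%:M 0 0 k2.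
pose B' : 'M_(1 + n) := block_mx 1%:M 0 0 (invmx k2).
have BB' : B *m B' = 1%:M.
  rewrite mulmx_block !(mul1mx, mulmx1, mul0mx, mulmx0, addr0, add0r) mulmxV //.
  by rewrite -scalar_mx_block.
exists (k1 *m B).
  apply: (GLoverM Gk1); apply: GLoverI BB'.
    by rewrite mxOver_block ?mxOver1 // mxOver0 ?rpred0.
  by rewrite mxOver_block ?mxOver1 // mxOver0 ?rpred0.
have -> : N *m (k1 *m B) = N1 *m B by rewrite mulmxA.
rewrite N1E mulmx_block !(mul0mx, mulmx0, mulmx1, addr0, add0r).
by apply: (@trig_block_mx _ 1 n); rewrite ?scalar_mx_is_trig.
Qed.
End ValuationRing.

(** * Places *)

(** The reversed polynomial turns a root [f^-1] of [p] into a root [f]. *)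
Lemma horner_rev (K : fieldType) (p : {poly K}) (f : K) m :
  f != 0 -> (size p <= m.+1)%N ->
  (\poly_(i < m.+1) p`_(m - i)).[f] = f ^+ m * p.[f^-1].
Proof.
move=> f0 sp; rewrite horner_poly (horner_coef_wide _ sp) mulr_sumr.
rewrite (reindex_inj rev_ord_inj) /=; apply: eq_bigr => i _.
rewrite subSS subKn ?leq_ord // mulrCA; congr (_ * _).
have -> : f ^+ m = f ^+ (m - i) * f ^+ i by rewrite -exprD subnK // leq_ord.
by rewrite exprVn mulfK // expf_neq0.
Qed.

Lemma subringClosed_of_set (R : pzRingType) (G : set R) : G 1 ->
  (forall x y, G x -> G y -> G (x - y)) ->
  (forall x y, G x -> G y -> G (x * y)) ->
  exists S : subringClosed R, forall x, (x \in S) = `[< G x >].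
Proof.
move=> G1 GB GM; pose p : {pred R} := fun x => `[< G x >].
have cp : GRing.subring_closed p.
  split; first exact/asboolP.
    by move=> x y /asboolP Gx /asboolP Gy; exact/asboolP/GB.
  by move=> x y /asboolP Gx /asboolP Gy; exact/asboolP/GM.
pose Sp := GRing.isSubringClosed.Build R p cp.
by exists (HB.pack_for (subringClosed R) p Sp).
Qed.

(* A subring [S] of [K * k] that contains the constants and meets [0 * k] only
   in [0] is the graph of a [k]-algebra morphism from a subring of [K] to
   [k]. *)
Section Places.
Variables (k : closedFieldType) (K : fieldType) (c : {rmorphism k -> K}).
Local Notation Kk := (K * k)%type.

Definition functional (S : {pred Kk}) : Prop := forall a, (0, a) \in S -> a = 0.

(** The reductions of the polynomials over [S] that vanish at [f] form an ideal [I] of [k[X]]. By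
    hypothesis it does not contain 1, so its elements have a common root [a] in the closed field
    [k], and [a] can serve as the value of the place at [f]. *)
Lemma place_extend (S : subringClosed Kk) (f : K) :
  (forall a, (c a, a) \in S) ->
  (forall P, P \is a polyOver S -> (map_poly fst P).[f] = 0 ->
    map_poly snd P <> 1) ->
  exists S' : subringClosed Kk, [/\ {subset S <= S'}, functional S' &
    exists a, (f, a) \in S'].
Proof.
move=> Sc noP.
pose I := [set q | exists P,
  [/\ P \is a polyOver S, (map_poly fst P).[f] = 0 & map_poly snd P = q]].
have [a aI] : exists a : k, forall q, I q -> root q a.
  have [[q [Iq q0]]|I0] := pselect (exists q, I q /\ q != 0); last first.
    exists 0 => q Iq; have [->|q0] := eqVneq q 0; first exact: root0.
    by case: I0; exists q.
  (* A nonzero element [p] of [I] of least size generates [I]; if it were constant, rescaling it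
     would put 1 in [I]. *)
  have ex_size : exists m, `[< exists2 q, I q /\ q != 0 & size q = m >].
    by exists (size q); apply/asboolP; exists q.
  case: (ex_minnP ex_size) => m /asboolP[p [[P [oP Pf Pp]] p0] <-] min_p.
  have /closed_rootP[a pa] : size p != 1.
    apply/negP => /size_poly1P[b b0 pb].
    apply: (noP ((c b^-1, b^-1)%:P * P)).
    + by rewrite rpredM ?polyOverC ?Sc.
    + by rewrite rmorphM hornerM Pf mulr0.
    + by rewrite rmorphM /= map_polyC /= Pp pb -polyCM mulVf.
  exists a => _ [Q [oQ Qf <-]].
  pose d := map_poly snd Q %/ p.
  (* The quotient by [p] is lifted through the constants to a polynomial over [S], so that the
     remainder stays in [I]. *)
  pose D := map_poly (fun b => (c b, b)) d.
  have Dd : map_poly snd D = d.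
    by apply/polyP => i; rewrite coef_map /D coef_map_id0 // rmorph0.
  have Ir : I (map_poly snd Q %% p).
    exists (Q - D * P); split.
    + rewrite rpredB // rpredM //; apply/polyOverP => i.
      by rewrite coef_map_id0 ?rmorph0 // Sc.
    + by rewrite rmorphB rmorphM /= hornerD hornerN hornerM Qf Pf mulr0 subr0.
    + rewrite rmorphB rmorphM /= Dd Pp {1}(divp_eq (map_poly snd Q) p).
      by rewrite addrC addKr.
  have r0 : map_poly snd Q %% p = 0.
    apply/eqP/negPn/negP => r0.
    suff : (size p <= size (map_poly snd Q %% p)%R)%N.
      by rewrite leqNgt ltn_modp p0.
    by apply/min_p/asboolP; exists (map_poly snd Q %% p).
  by rewrite (divp_eq (map_poly snd Q) p) r0 addr0 rootM pa orbT.
(* This is the ring obtained from [S] by adjoining [(f, a)]. *)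
pose G := [set P.[(f, a)] | P in [set P : {poly Kk} | P \is a polyOver S]].
have [|||S' S'G] := @subringClosed_of_set _ G.
- by exists 1; rewrite /= ?rpred1 // hornerC.
- by move=> _ _ [P oP <-] [Q oQ <-]; exists (P - Q);
    rewrite /= ?rpredB // hornerD hornerN.
- by move=> _ _ [P oP <-] [Q oQ <-]; exists (P * Q);
    rewrite /= ?rpredM // hornerM.
exists S'; split.
- move=> z zS; rewrite S'G; apply/asboolP; exists z%:P; last by rewrite hornerC.
  by rewrite /= polyOverC.
- move=> b; rewrite S'G => /asboolP[P oP PE].
  have P1 : (map_poly fst P).[f] = 0.
    by rewrite -[f]/((f, a).1) (horner_map fst) PE.
  have /eqP := aI _ (ex_intro _ P (And3 oP P1 erefl)).
  by rewrite -[a]/((f, a).2) (horner_map snd) PE.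
- exists a; rewrite S'G; apply/asboolP; exists 'X; last by rewrite hornerX.
  by rewrite /= polyOverX.
Qed.

(* A root [f] of [P] and [f^-1] of [Q], where [P] and [Q] reduce to [1], is
   impossible: the reversal of the shorter one eliminates the leading term of
   the longer one. *)
Lemma place_dichotomy (S : subringClosed Kk) (f : K) (P Q : {poly Kk}) :
  functional S -> f != 0 -> P \is a polyOver S -> Q \is a polyOver S ->
  (map_poly fst P).[f] = 0 -> map_poly snd P = 1 ->
  (map_poly fst Q).[f^-1] = 0 -> map_poly snd Q <> 1.
Proof.
move=> fS; have [m] := ubnP (size P + size Q); elim: m => // m IH in f P Q *.
wlog le_QP : f P Q / (size Q <= size P)%N => [hwlog|].
  move=> ltm f0 oP oQ Pf P1 Qf Q1.
  case/orP: (leq_total (size Q) (size P)) => le.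
    exact: (hwlog f P Q).
  apply: (hwlog f^-1 Q P) => //; rewrite ?invr_eq0 ?invrK //.
  by rewrite addnC.
move=> ltm f0 oP oQ Pf P1 Qf Q1.
have sP2 : (1 < size P)%N.
  rewrite ltnNge; apply/negP => /size1_polyC PE.
  have z2 : (P`_0).2 = 1.
    by have /polyP/(_ 0%N) := P1; rewrite coef_map coef1.
  have z1 : (P`_0).1 = 0 by move: Pf; rewrite PE map_polyC hornerC coefC.
  have := polyOverP oP 0%N; case: (P`_0) z1 z2 => /= ? b -> ->.
  by move=> /fS/eqP; rewrite oner_eq0.
case sP : (size P) sP2 => [|[|d]] // _; set n := d.+1 in sP.
pose a := P`_n; pose b := Q`_0.
pose Qr := \poly_(i < n.+1) Q`_(n - i).
have a2 : a.2 = 0 by have /polyP/(_ n) := P1; rewrite coef_map coef1.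
have b2 : b.2 = 1 by have /polyP/(_ 0%N) := Q1; rewrite coef_map coef1.
have oQr : Qr \is a polyOver S.
  apply/polyOverP => i; rewrite coef_poly.
  by case: ifP; rewrite ?rpred0 ?(polyOverP oQ).
have sQ : (size (map_poly fst Q) <= n.+1)%N.
  by apply: leq_trans (size_poly _ _) _; rewrite -sP.
(* The coefficients of degree [n] cancel, since that of [Qr] is [b]. As [a] reduces to 0 and [b] to
   1, [P'] still reduces to 1. *)
pose P' := b%:P * P - a%:P * Qr.
apply: (IH f P' Q) Q1 => //.
- rewrite -ltnS; apply: leq_trans ltm; rewrite ltnS ltn_add2r sP.
  apply/leq_sizeP => j; rewrite leq_eqVlt => /orP[/eqP <-|ltj].
    by rewrite coefB !coefCM coef_poly ltnSn subnn -/a -/b mulrC subrr.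
  rewrite coefB !coefCM coef_poly ltnNge ltj mulr0 subr0.
  by rewrite nth_default ?mulr0 // sP.
- by rewrite rpredB // rpredM // polyOverC (polyOverP oP, polyOverP oQ).
- rewrite rmorphB !rmorphM /= hornerD hornerN !hornerM Pf mulr0 sub0r.
  have -> : map_poly fst Qr = \poly_(i < n.+1) (map_poly fst Q)`_(n - i).
    apply/polyP => i; rewrite coef_map [RHS]coef_poly coef_map /Qr coef_poly.
    by case: ifP.
  by rewrite horner_rev // Qf !mulr0 oppr0.
- rewrite rmorphB !rmorphM /= !map_polyC /= P1 a2 b2.
  by rewrite polyC0 mul0r subr0 mulr1.
Qed.

(** Zorn's lemma gives a maximal functional subring containing the constants. By maximality, [f]
    gets a value unless some polynomial over [S] vanishes at [f] and reduces to 1; this cannot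
    happen for both [f] and [f^-1]. *)
Lemma exists_place : exists S : subringClosed Kk,
  [/\ forall a, (c a, a) \in S, functional S &
      forall f, (exists a, (f, a) \in S) \/ (exists a, (f^-1, a) \in S)].
Proof.
pose good (G : set Kk) := [/\ forall a, G (c a, a),
  forall x y, G x -> G y -> G (x - y), forall x y, G x -> G y -> G (x * y) &
  forall a, G (0, a) -> a = 0].
(* The empty chain has an empty union, which is not [good]; hence the guard. The graph of the
   constants shows afterwards that the maximal [G] is nonempty. *)
have [|G [Ggood Gmax]] := @Zorn_bigcup Kk [set G | G !=set0 -> good G].
  move=> FF FFgood tot [x [X FX Xx]].
  have gX : good X by apply: FFgood => //; exists x.
  have gU u v : (\bigcup_(X in FF) X) u -> (\bigcup_(X in FF) X) v ->
      exists Y, [/\ FF Y, good Y, Y u & Y v].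
    move=> [Y FY Yu] [Z FZ Zv]; case: (tot _ _ FY FZ) => [YZ|ZY].
      by exists Z; split => //; [apply: FFgood => //; exists v|exact: YZ].
    by exists Y; split => //; [apply: FFgood => //; exists u|exact: ZY].
  split.
  - by move=> a; exists X => //; case: gX.
  - move=> u v uU vU; have [Y [FY [_ YB _ _] Yu Yv]] := gU u v uU vU.
    by exists Y => //; exact: YB.
  - move=> u v uU vU; have [Y [FY [_ _ YM _] Yu Yv]] := gU u v uU vU.
    by exists Y => //; exact: YM.
  - move=> a aU; have [Y [FY [_ _ _ Y0] Ya _]] := gU _ _ aU aU.
    exact: Y0.
have {}Ggood : good G.
  apply: Ggood; apply/set0P/negP => /eqP G0.
  apply: (Gmax [set (c a, a) | a in setT]); first last.
    move=> _; split.
    - by move=> a; exists a.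
    - by move=> _ _ [a _ <-] [b _ <-]; exists (a - b); rewrite // rmorphB.
    - by move=> _ _ [a _ <-] [b _ <-]; exists (a * b); rewrite // rmorphM.
    - by move=> a [b _ [/eqP]]; rewrite fmorph_eq0 => /eqP -> <-.
  by rewrite G0; split=> // /(_ (c 0, 0)); apply; exists 0.
have [Gc GB GM G0] := Ggood.
have [|S SG] := subringClosed_of_set _ GB GM.
  by have := Gc 1; rewrite rmorph1.
have Sc a : (c a, a) \in S by rewrite SG; exact/asboolP.
have fS : functional S by move=> a; rewrite SG => /asboolP; exact: G0.
exists S; split => // f.
have max (S' : subringClosed Kk) :
    {subset S <= S'} -> functional S' -> {subset S' <= S}.
  move=> SS' fS'; apply: contrapT => nS.
  apply: (Gmax [set x | x \in S']).
    split; last first.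
      by move=> S'G; apply: nS => x /S'G Gx; rewrite SG; exact/asboolP.
    by move=> x Gx; apply: SS'; rewrite SG; exact/asboolP.
  move=> _; split.
  - by move=> a; apply: SS'.
  - by move=> x y; exact: rpredB.
  - by move=> x y; exact: rpredM.
  - exact: fS'.
have ext h : (exists a, (h, a) \in S) \/ exists P,
    [/\ P \is a polyOver S, (map_poly fst P).[h] = 0 & map_poly snd P = 1].
  have [?|noP] := pselect (exists P,
    [/\ P \is a polyOver S, (map_poly fst P).[h] = 0 & map_poly snd P = 1]).
    by right.
  left; have [|S' [SS' fS' [a aS']]] := place_extend (f := h) Sc.
    by move=> P oP Ph P1; apply: noP; exists P.
  by exists a; exact: max aS'.
have [->|f0] := eqVneq f 0; first by left; exists 0; rewrite -(rmorph0 c).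
have [|[P [oP Pf P1]]] := ext f; first by left.
have [|[Q [oQ Qf Q1]]] := ext f^-1; first by right.
by case: (place_dichotomy fS f0 oP oQ Pf P1 Qf Q1).
Qed.
End Places.

(** * Points and local rings of a curve *)

Lemma poly_factorX (K : idomainType) (p : {poly K}) : p != 0 ->
  exists m q b, b != 0 /\ p = (q * 'X + b%:P) * 'X^m.
Proof.
move=> p0; have [m [q]] := multiplicity_XsubC p 0; rewrite p0 subr0 /= => qr pE.
have [q' [b qE]] : exists q' b, q = q' * 'X + b%:P.
  elim/poly_ind: q {qr pE} => [|q b _]; last by exists q, b.
  by exists 0, 0; rewrite mul0r addr0.
exists m, q', b; split; last by rewrite -qE.
by apply: contraNneq qr => b0; rewrite qE b0 rootE !hornerE.
Qed.

Lemma mmap_homogZ (A B : comNzRingType) (c : {rmorphism A -> B}) n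
    (v : 'I_n -> B) (l : B) d (P : {mpoly A[n]}) : P \is d.-homog ->
  mpoly.mmap c (fun i => l * v i) P = l ^+ d * mpoly.mmap c v P.
Proof.
move=> hP; rewrite /mpoly.mmap mulr_sumr; apply: eq_big_seq => m mP.
rewrite mulrCA; congr (_ * _); rewrite /mpoly.mmap1.
under eq_bigr do rewrite exprMn.
rewrite big_split /= prodrXr -mpoly.mdegE; congr (_ ^+ _ * _).
exact: (mpoly.dhomogP _ _ _ hP).
Qed.

(** When [S] is the graph of a place, this says that the place commutes with the evaluation of
    polynomials. *)
Lemma mmap_rel (A B C : comNzRingType) (S : subringClosed (B * C)%type)
    (b : {rmorphism A -> B}) (c : {rmorphism A -> C}) n
    (v : 'I_n -> B) (w : 'I_n -> C) (P : {mpoly A[n]}) :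
  (forall a, (b a, c a) \in S) -> (forall i, (v i, w i) \in S) ->
  (mpoly.mmap b v P, mpoly.mmap c w P) \in S.
Proof.
move=> bcS vwS; rewrite /mpoly.mmap.
apply: (big_ind2 (fun x y => (x, y) \in S)); first exact: rpred0.
  by move=> x y x' y' Sx Sy; exact: (rpredD Sx Sy).
move=> m _; suff : (mpoly.mmap1 v m, mpoly.mmap1 w m) \in S.
  exact: (rpredM (bcS _)).
rewrite /mpoly.mmap1; apply: (big_ind2 (fun x y => (x, y) \in S)).
- exact: rpred1.
- by move=> x y x' y' Sx Sy; exact: (rpredM Sx Sy).
- move=> i _; elim: (m i) => [|j IH]; first exact: rpred1.
  by rewrite !exprS; exact: (rpredM (vwS i) IH).
Qed.

Section Points.
Variables (R : realType) (X : curve R).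
Local Notation F := (fun_field X).
Local Notation c := (constants X).

(** The generic coordinates are divided by one that divides them all in the valuation ring of a
    place; the residues [w] of the quotients are then the coordinates of a point, not all zero
    because [w i = 1]. *)
Lemma point_exists : inhabited (point X).
Proof.
have [S [Sc fS placeS]] := exists_place c.
pose dom := [set f : F | exists a, (f, a) \in S].
have [|||D DE] := @subringClosed_of_set F dom.
- by exists 1; exact: rpred1.
- by move=> f h [a Sa] [b Sb]; exists (a - b); exact: (rpredB Sa Sb).
- by move=> f h [a Sa] [b Sb]; exists (a * b); exact: (rpredM Sa Sb).
have valD (f : F) : f \in D \/ f^-1 \in D.
  by case: (placeS f) => ?; [left|right]; rewrite DE; exact/asboolP.
have [i Hi] := exists_divisor_of_all valD (@gen R X).
have gi0 : gen i != 0.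
  have [j gj] := gen_neq0 X; apply: contraNneq gj => gi.
  by have [r _ ->] := Hi j; rewrite gi mulr0.
have [r Dr rE] := fin_all_exists2 Hi.
have /fin_all_exists[w Sw] j : exists a, (r j, a) \in S.
  by have := Dr j; rewrite DE => /asboolP.
have wi : w i = 1.
  have ri : r i = 1 by apply: (mulIf gi0); rewrite mul1r -rE.
  apply/eqP; rewrite -subr_eq0; apply/eqP/fS.
  rewrite -(subrr (r i)) {2}ri -(rmorph1 c); exact: (rpredB (Sw i) (Sc 1)).
pose v := \row_j w j.
have v0 : v != 0.
  by apply/eqP => /rowP/(_ i)/eqP; rewrite !mxE wi oner_eq0.
suff lv : @locus R X <[v]>%VS by exact: inhabits (SigSub (mem_set lv)).
split; first by rewrite dim_vline v0.
move=> d P hP P0; rewrite /at_line.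
have /vlineP[k ->] := memv_pick <[v]>%VS.
have -> : mpoly.meval ((k *: v) ord0) P = k ^+ d * mpoly.meval w P.
  rewrite -(mmap_homogZ _ _ _ hP) /mpoly.meval; congr (mpoly.mmap _ _ _).
  by apply/funext => j; rewrite !mxE.
have Pr : mpoly.mmap c r P = 0.
  have : gen i ^+ d * mpoly.mmap c r P = 0.
    rewrite -(mmap_homogZ _ _ _ hP) -P0; congr (mpoly.mmap _ _ _).
    by apply/funext => j; rewrite [RHS]rE mulrC.
  by move/eqP; rewrite mulf_eq0 expf_eq0 (negbTE gi0) andbF => /eqP.
have : (mpoly.mmap c r P, mpoly.mmap idfun w P) \in S by exact: mmap_rel.
by rewrite Pr => /fS; rewrite /mpoly.meval => ->; rewrite mulr0.
Qed.

Definition eval1 (f : F) : {poly R[i]} -> F := horner_eval f \o map_poly c.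
HB.instance Definition _ f := GRing.RMorphism.on (eval1 f).

(** The outer variable is evaluated at [h] and the inner one at [f]. *)
Definition eval2 (f h : F) : {poly {poly R[i]}} -> F :=
  horner_eval h \o map_poly (eval1 f).
HB.instance Definition _ f h := GRing.RMorphism.on (eval2 f h).

Lemma eval1C f a : eval1 f a%:P = c a.
Proof. by rewrite /eval1 /= map_polyC /horner_eval hornerC. Qed.

Lemma eval1X f : eval1 f 'X = f.
Proof. by rewrite /eval1 /= map_polyX /horner_eval hornerX. Qed.

Lemma eval2C f h p : eval2 f h p%:P = eval1 f p.
Proof. by rewrite /eval2 /= map_polyC /horner_eval hornerC. Qed.

Lemma eval2X f h : eval2 f h 'X = h.
Proof. by rewrite /eval2 /= map_polyX /horner_eval hornerX. Qed.

Lemma algebraic_dependence f h : exists2 p, p != 0 & eval2 f h p = 0.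
Proof.
have /existsNP[P /not_implyP[PE /eqP P0]] :=
  @trdeg_le1 R X (fun i => if i == 0 then f else h).
pose p : {poly {poly R[i]}} := mpoly.mmap (polyC \o polyC)
  (fun i => if i == 0 :> 'I_2 then 'X%:P else 'X) P.
exists p.
  apply: contraNneq P0 => p0; apply/eqP/mpoly.mpolyP => m.
  have := congr1 (fun q : {poly {poly R[i]}} => (q`_(m 1))`_(m 0)) p0.
  rewrite mpoly.mcoeff0 !coef0 => <-; rewrite /p /mpoly.mmap.
  rewrite coef_sum coef_sum.
  (* Distinct monomials of [P] contribute to distinct coefficients of [p], so [P] can be recovered
     from [p]. *)
  have pE m' : ((((polyC \o polyC) (mpoly.mcoeff m' P) * mpoly.mmap1
      (fun i => if i == 0 :> 'I_2 then 'X%:P else 'X) m') : {poly {poly R[i]}})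
      `_(m 1))`_(m 0) = mpoly.mcoeff m' P *+ (m' == m).
    rewrite /mpoly.mmap1 big_ord_recl big_ord1 /= coefCM coefCM.
    have -> : lift 0 0 = 1 :> 'I_2 by exact: val_inj.
    rewrite -polyC_exp coefCM coefXn.
    rewrite mulr_natr coefMn coefXn.
    have -> : (m' == m) = (m 0 == m' 0) && (m 1 == m' 1).
      apply/eqP/andP => [->|[/eqP e0 /eqP e1]]; first by rewrite !eqxx.
      apply/mpoly.mnmP => i.
      case: (unliftP ord0 i) => [k|] ->; last by rewrite -e0.
      by rewrite ord1; have -> : lift ord0 ord0 = 1 :> 'I_2 by exact: val_inj.
    by case: (m 0 == _); case: (m 1 == _);
      rewrite ?mulr0n ?mulr1n ?mulr1 ?mulr0.
  under eq_bigr do rewrite pE.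
  have [mP|mP] := boolP (m \in mpoly.msupp P).
    rewrite (bigD1_seq m) ?mpoly.msupp_uniq //= eqxx big1 ?addr0 // => m'.
    by move=> /negbTE ->.
  rewrite mpoly.memN_msupp_eq0 // big_seq big1 // => m' m'P.
  by case: eqP m'P mP => [-> ->|].
rewrite /p /mpoly.mmap rmorph_sum -[RHS]PE /mpoly.mmap; apply: eq_bigr => m _.
rewrite rmorphM /= eval2C eval1C /mpoly.mmap1 rmorph_prod; congr (_ * _).
apply: eq_bigr => i _; rewrite rmorphXn.
by case: eqP => _ /=; rewrite ?eval2C ?eval1X ?eval2X.
Qed.

End Points.

(** * Local rings of a smooth curve are valuation rings *)

Section LocalRings.
Variables (R : realType) (X : curve R).
Local Notation F := (fun_field X).
Local Notation c := (constants X).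
Implicit Types (x : point X) (f t : F).

Lemma constants_loc_ring x a : c a \in loc_ring x.
Proof.
apply/asboolP; exists 0%N, (mpoly.mpolyC _ a), 1; split.
- rewrite -[mpoly.mpolyC _ a]mulr1 mpoly.mul_mpolyC.
  by rewrite mpoly.dhomogZ ?mpoly.dhomog1.
- exact: mpoly.dhomog1.
- by rewrite /at_line rmorph1 oner_neq0.
- by rewrite /at_gen rmorph1 divr1 mpoly.mmapC.
Qed.

Lemma max_ideal_or_unit x f :
  f \in loc_ring x -> max_ideal x f \/ f^-1 \in loc_ring x.
Proof.
move=> /asboolP[d [P [Q [hP hQ Qx ->]]]].
have [Px|Px] := eqVneq (at_line P (val x)) 0; [left|right].
  by exists d, P, Q.
by apply/asboolP; exists d, Q, P; rewrite invf_div.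
Qed.

(** If [P / Q = 1], the form [P - Q] vanishes at the generic point, hence at [x], where [P] vanishes
    and [Q] does not. *)
Lemma max_ideal_neq1 x : ~ max_ideal x 1.
Proof.
move=> [d [P [Q [hP hQ Px Qx PQ]]]].
have Q0 := at_gen_neq0 hQ Qx.
have [_ /(_ d (P - Q))] := set_mem (valP x).
rewrite rpredB // /at_gen /at_line !rmorphB /= -/(at_gen P) -/(at_gen Q).
rewrite -(divfK Q0 (at_gen P)) -PQ mul1r subrr => /(_ isT erefl) /eqP.
by rewrite subr_eq0 -/(at_line P _) Px eq_sym; exact/negP.
Qed.

(** The product of finitely many denominators defines a common neighbourhood. *)
Lemma loc_ring_nbhs x (s : seq F) : {subset s <= loc_ring x} ->
  exists d Q, [/\ Q \is d.-homog, at_line Q (val x) != 0 &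
    forall y : point X, at_line Q (val y) != 0 -> {subset s <= loc_ring y}].
Proof.
elim: s => [|f s IH] sx.
  by exists 0%N, 1; rewrite mpoly.dhomog1 /at_line rmorph1 oner_neq0.
have [f' f's|d [Q [hQ Qx HQ]]] := IH; first by apply: sx; rewrite inE f's orbT.
have /asboolP[e [P [Q' [hP hQ' Q'x fE]]]] := sx f (mem_head _ _).
exists (d + e)%N, (Q * Q'); split; first exact: mpoly.dhomogM.
  by rewrite at_lineM mulf_neq0.
move=> y; rewrite at_lineM mulf_eq0 negb_or => /andP[Qy Q'y] f'.
rewrite inE => /orP[/eqP ->|]; last exact: HQ.
by apply/asboolP; exists e, P, Q'.
Qed.

Lemma loc_ring_frac x f : exists a b,
  [/\ a \in loc_ring x, b \in loc_ring x, b != 0 & f = a / b].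
Proof.
have [i vi] : exists i, vpick (val x) ord0 i != 0.
  have [dx _] := set_mem (valP x).
  have : vpick (val x) != 0 by rewrite vpick0 -dimv_eq0 dx.
  by case/rV0Pn => i; exists i.
have [d [P [Q [hP hQ Q0 ->]]]] := gen_fun_field f.
(* A power of a coordinate that does not vanish at [x] has the degree of [P] and [Q] and serves as a
   denominator for both. *)
pose L : {mpoly R[i][(pdim X).+1]} := mpoly.mpolyX _ (mpoly.mnm1 i) ^+ d.
have hL : L \is d.-homog.
  rewrite -[d]mul1n; apply: mpoly.dhomogMn; rewrite mpoly.dhomogX.
  by rewrite /= mpoly.mdeg1.
have Lx : at_line L (val x) != 0.
  by rewrite /at_line rmorphXn /= mpoly.mevalXU expf_neq0.
have L0 := at_gen_neq0 hL Lx.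
exists (at_gen P / at_gen L), (at_gen Q / at_gen L); split.
- by apply/asboolP; exists d, P, L.
- by apply/asboolP; exists d, Q, L.
- by rewrite mulf_neq0 // invr_eq0.
- by rewrite -mulf_div divff ?invr_eq0 ?mulr1 // mulf_div mulrC.
Qed.

Section Uniformizer.
Variables (x : point X) (t : F).
Hypothesis tx : uniformizer x t.

Lemma uniformizer_max f : f \in loc_ring x -> max_ideal x (t * f).
Proof. by move=> fx; rewrite tx; exists f. Qed.

Lemma uniformizer_loc_ring : t \in loc_ring x.
Proof.
have [d [P [Q [hP hQ Px Qx tE]]]] := uniformizer_max (rpred1 _).
by apply/asboolP; exists d, P, Q; rewrite -tE mulr1.
Qed.

Lemma not_uniformizer_dvd1 f : f \in loc_ring x -> t * f <> 1.
Proof.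
by move=> fx tf; have := uniformizer_max fx; rewrite tf => /max_ideal_neq1.
Qed.

Lemma eval1_loc_ring (p : {poly R[i]}) : eval1 t p \in loc_ring x.
Proof.
apply: rpred_horner uniformizer_loc_ring; apply/polyOverP => i.
by rewrite coef_map constants_loc_ring.
Qed.

Lemma eval2_loc_ring f p : f \in loc_ring x -> eval2 t f p \in loc_ring x.
Proof.
move=> fx; apply: rpred_horner fx; apply/polyOverP => i.
by rewrite coef_map eval1_loc_ring.
Qed.

(* An element divisible by all powers of [t] vanishes: a polynomial relation
   between it and [t] with a nonzero constant term [b(t)] would make [b(t)],
   hence a power of [t] times a unit, divisible by all powers of [t]. *)
Lemma uniformizer_power f : f \in loc_ring x -> f != 0 ->
  exists m u,
    [/\ u \in loc_ring x, u^-1 \in loc_ring x, u != 0 & f = t ^+ m * u].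
Proof.
move=> fx f0; apply: contrapT => nf.
have tdvd m : exists2 h, h \in loc_ring x & f = t ^+ m * h.
  elim: m => [|m [h hx fE]]; first by exists f; rewrite // mul1r.
  case: (max_ideal_or_unit hx) => [|hVx]; last first.
    case: nf; exists m, h; split=> //.
    by apply: contraNneq f0 => h0; rewrite fE h0 mulr0.
  rewrite tx => -[h' h'x hE]; exists h' => //.
  by rewrite fE -hE mulrA exprSr.
have t0 : t != 0.
  have [h _ fE] := tdvd 1%N.
  by apply: contraNneq f0 => t0; rewrite fE t0 expr1 mul0r.
have [p p0 pE] := algebraic_dependence t f.
have [k [q [b [b0 pq]]]] := poly_factorX p0.
have [m [r [a [a0 bE]]]] := poly_factorX b0.
have {}pE : eval2 t f q * f + eval1 t b = 0.
  move: pE; rewrite pq rmorphM rmorphXn /= eval2X => /eqP.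
  rewrite mulf_eq0 expf_eq0 (negbTE f0) andbF orbF => /eqP.
  by rewrite rmorphD rmorphM /= eval2X eval2C.
(* One power more than the order [m] of [b(t)]: after cancelling [t ^+ m], the nonzero constant
   [c a] is a multiple of [t], which makes [t] a unit. *)
have [h hx fE] := tdvd m.+1.
have {pE} : t ^+ m * (t * (h * eval2 t f q + eval1 t r) + c a) = 0.
  rewrite -[RHS]pE bE rmorphM rmorphXn rmorphD rmorphM /= eval1X eval1C.
  by rewrite [X in _ = _ * X + _]fE exprSr; ring.
move/eqP; rewrite mulf_eq0 expf_eq0 (negbTE t0) andbF /= addr_eq0 => /eqP tE.
apply: (@not_uniformizer_dvd1 (- c a^-1 * (h * eval2 t f q + eval1 t r))).
  rewrite rpredM ?rpredN ?constants_loc_ring // rpredD ?eval1_loc_ring //.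
  by rewrite rpredM // eval2_loc_ring.
by rewrite mulrCA tE mulrNN fmorphV mulVf // fmorph_eq0.
Qed.

(** Numerator and denominator are powers of [t] times units, so the exponents decide. *)
Lemma uniformizer_valuation f : f \in loc_ring x \/ f^-1 \in loc_ring x.
Proof.
have [a [b [ax bx b0 ->]]] := loc_ring_frac x f.
have [->|a0] := eqVneq a 0; first by left; rewrite mul0r rpred0.
have [k [u [ux uVx u0 aE]]] := uniformizer_power ax a0.
have [m [v [vx vVx v0 bE]]] := uniformizer_power bx b0.
have [tk tm] : t ^+ k != 0 /\ t ^+ m != 0.
  by split; [apply: contraNneq a0|apply: contraNneq b0];
    rewrite ?aE ?bE => ->; rewrite mul0r.
have tX j : t ^+ j \in loc_ring x by rewrite rpredX // uniformizer_loc_ring.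
rewrite invf_div aE bE -!mulf_div.
case: (leqP m k) => [|/ltnW] le; [left|right].
  by rewrite -(subnK le) exprD mulfK // rpredM // rpredM.
by rewrite -(subnK le) exprD mulfK // rpredM // rpredM.
Qed.

End Uniformizer.
End LocalRings.

(** * Derivations *)

Lemma deriv_eq0 (K : numDomainType) (p : {poly {poly K}}) :
  p^`() = 0 -> p = (p`_0)%:P.
Proof.
move=> p0; apply/polyP => -[|i]; rewrite coefC //=.
have /polyP/(_ i)/polyP q0 := p0; apply/polyP => j.
have /eqP := q0 j; rewrite coef_deriv coefMn !coef0 mulrn_eq0 /=.
by move/eqP.
Qed.

Section Derivations.
Variables (R : realType) (X : curve R).
Local Notation F := (fun_field X).
Local Notation c := (constants X).

(** Transcendence is stated for [mpoly] in one variable; this carries it over to [{poly R[i]}]. *)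
Lemma poly1_mpoly (p : {poly R[i]}) :
  exists2 P : mpoly.mpoly 1 R[i], mpoly.mmap polyC (fun=> 'X) P = p &
    forall f : F, mpoly.mmap c (fun=> f) P = eval1 f p.
Proof.
elim/poly_ind: p => [|p a [P Pp Pf]].
  by exists 0; rewrite ?raddf0 // => f; rewrite !raddf0.
exists (P * mpoly.mpolyX _ (mpoly.mnm1 ord0) + mpoly.mpolyC _ a).
  by rewrite rmorphD rmorphM /= Pp mpoly.mmapX mpoly.mmap1U mpoly.mmapC.
move=> f; rewrite !(rmorphD, rmorphM) /= Pf mpoly.mmapX mpoly.mmap1U.
by rewrite mpoly.mmapC eval1X eval1C.
Qed.

Lemma exists_transcendental : exists f : F, forall p, eval1 f p = 0 -> p = 0.
Proof.
have [f fE] := trdeg_ge1 X; exists (f ord0) => p p0.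
have [P Pp PE] := poly1_mpoly p; rewrite -Pp; suff -> : P = 0 by rewrite raddf0.
apply: fE; rewrite -[RHS]p0 -PE; congr (mpoly.mmap _ _ _).
by apply/funext => i; rewrite ord1.
Qed.

Lemma derP (D : der X) : [/\ forall a, D (c a) = 0,
  forall f h, D (f + h) = D f + D h &
  forall f h, D (f * h) = f * D h + h * D f].
Proof. by case: D => D /= /asboolP. Qed.

Lemma der0 (D : der X) : D 0 = 0.
Proof. by have [Dc _ _] := derP D; rewrite -[X in D X](rmorph0 c) Dc. Qed.

Lemma der_eval1 (D : der X) f p : D f = 0 -> D (eval1 f p) = 0.
Proof.
have [Dc DD DM] := derP D; move=> Df; elim/poly_ind: p => [|p a IH].
  by rewrite rmorph0 der0.
rewrite rmorphD rmorphM /= eval1X eval1C DD DM Df IH Dc.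
by rewrite !mulr0 !addr0.
Qed.

Lemma der_eval2 (D : der X) f h p : D f = 0 ->
  D (eval2 f h p) = eval2 f h p^`() * D h.
Proof.
have [Dc DD DM] := derP D; move=> Df; elim/poly_ind: p => [|p a IH].
  by rewrite deriv0 !rmorph0 mul0r der0.
rewrite derivD derivM derivX derivC mulr1 addr0 !(rmorphD, rmorphM) /=.
rewrite eval2X eval2C DD DM (der_eval1 _ Df) IH addr0; ring.
Qed.

(* In characteristic 0, differentiating a polynomial relation of minimal degree
   shows that a derivation that kills a transcendence basis is zero. *)
Lemma der_eq0 (D : der X) f h : (forall p, eval1 f p = 0 -> p = 0) ->
  D f = 0 -> D h = 0.
Proof.
move=> tf Df; have [p p0 pE] := algebraic_dependence f h.
have [m] := ubnP (size p); elim: m => // m IH in p p0 pE *; rewrite ltnS => sp.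
have [//|Dh] := eqVneq (D h) 0.
have p'E : eval2 f h p^`() = 0.
  apply/eqP; rewrite -(mulIr_eq0 _ (mulIf Dh)) -der_eval2 // pE.
  by rewrite der0.
have [p'0|p'0] := eqVneq p^`() 0; last first.
  apply: (IH _ p'0 p'E); apply: leq_trans sp.
  exact: lt_size_deriv.
(* A relation with zero derivative involves [f] alone, against its transcendence. *)
have pC := deriv_eq0 p'0; have : eval2 f h (p`_0)%:P = 0 by rewrite -pC.
by rewrite eval2C => /tf q0; rewrite pC q0 eqxx in p0.
Qed.

(** A derivation is determined by its value at a transcendental [f]. If all of them kill [f], they
    are all zero and [D0 = 0] will do. *)
Lemma der_dim1 : exists D0 : der X, forall D, exists a, D = a *: D0.
Proof.
have [f tf] := exists_transcendental.
have D_eq0 (D : der X) : D f = 0 -> D = 0.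
  by move=> Df; apply/val_inj/funext => h; exact: der_eq0 tf Df.
have [[D0 D0f]|noD] := pselect (exists D0 : der X, D0 f != 0).
  exists D0 => D; exists (D f / D0 f); apply/eqP; rewrite -subr_eq0; apply/eqP.
  apply: D_eq0; rewrite -[LHS]/(D f - D f / D0 f * D0 f).
  by rewrite divfK // subrr.
exists 0 => D; exists 0; rewrite scaler0; apply: D_eq0.
apply/eqP/negPn/negP => Df.
by apply: noD; exists D.
Qed.

End Derivations.

(** * Borel reductions *)

Section Frames.
Variables (R : realType) (X : curve R).
Local Notation F := (fun_field X).
Local Notation c := (constants X).
Local Notation GLover x k := (GLover (loc_ring x : {pred F}) k).

Lemma zariski_openI (U V : set (point X)) :
  zariski_open U -> zariski_open V -> zariski_open (U `&` V).
Proof.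
move=> oU oV x [/oU[d [P [hP Px PU]]] /oV[e [Q [hQ Qx QV]]]].
exists (d + e)%N, (P * Q); split; first exact: mpoly.dhomogM.
  by rewrite at_lineM mulf_neq0.
by move=> y; rewrite at_lineM mulf_eq0 negb_or => /andP[/PU Uy /QV Vy].
Qed.

Lemma zariski_open_at_line d (Q : {mpoly R[i][(pdim X).+1]}) : Q \is d.-homog ->
  zariski_open [set x : point X | at_line Q (val x) != 0].
Proof. by move=> hQ x Qx; exists d, Q. Qed.

Lemma GLover_nbhs n (x : point X) (k : 'M[F]_n) : GLover x k ->
  exists U, [/\ U x, zariski_open U & forall y, U y -> GLover y k].
Proof.
move=> [uk /mxOverP ok /mxOverP ok'].
have [|d [Q [hQ Qx HQ]]] := @loc_ring_nbhs R X x
    ([seq k ij.1 ij.2 | ij : 'I_n * 'I_n] ++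
     [seq invmx k ij.1 ij.2 | ij : 'I_n * 'I_n]).
  by move=> f; rewrite mem_cat => /orP[] /mapP[ij _ ->]; [exact: ok|exact: ok'].
exists [set y | at_line Q (val y) != 0].
split => //; first exact: (zariski_open_at_line hQ).
move=> y Qy; split => //; apply/mxOverP => i j; apply: (HQ y Qy);
  rewrite mem_cat; apply/orP; [left|right];
  by apply/mapP; exists (i, j); rewrite ?mem_enum.
Qed.

Lemma mx_span_GL n (x : point X) (k e : 'M[F]_n) : GLover x k ->
  mx_span x (k *m e) = mx_span x e.
Proof.
move=> [uk ok ok']; apply/seteqP; split => _ [v /= ov <-].
  by exists (v *m k); rewrite ?mulmxA //=; exact: mxOverM.
exists (v *m invmx k) => /=; first exact: mxOverM.
by rewrite mulmxA mulmxKV.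
Qed.

Lemma GLover_constants n (g : 'M[R[i]]_n) (x : point X) : g \in unitmx ->
  GLover x (map_mx c g).
Proof.
move=> ug; apply: (@GLoverI _ _ _ _ (map_mx c (invmx g))).
- by apply/mxOverP => i j; rewrite mxE constants_loc_ring.
- by apply/mxOverP => i j; rewrite mxE constants_loc_ring.
- by rewrite -map_mxM mulmxV // map_mx1.
Qed.

End Frames.

(** * Flags and eigenvalues of Higgs fields *)

Section HiggsBundles.
Variables (R : realType) (X : curve R) (n : nat).
Local Notation F := (fun_field X).
Local Notation c := (constants X).
Local Notation GLover x k := (GLover (loc_ring x : {pred F}) k).
Implicit Types (E : higgs X n) (g : 'M[R[i]]_n).
Implicit Types (alpha : 'I_n -> pluricanonical X 1).

(** The rows of [b] give an invariant flag of the generic stalk. Near each point the Iwasawa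
    decomposition adapts a local frame to it, which extends the flag over the whole curve. *)
Lemma borel_reduction_trig g E (b : 'M[F]_n) : smooth X -> g \in unitmx ->
  b \in unitmx -> (forall D, is_trig_mx (b *m phi E D *m invmx b)) ->
  borel_reduction g E.
Proof.
move=> smoothX ug ub tb; pose gF := map_mx c g.
have ugF : gF \in unitmx by rewrite map_unitmx.
have frame x : exists Ue : set (point X) * 'M[F]_n,
    [/\ Ue.1 x, zariski_open Ue.1, frame_on Ue.1 (vbundle E) Ue.2 &
      exists2 S, S \in unitmx /\ is_trig_mx S & gF *m Ue.2 = S *m b].
  have [U [e [Ux oU [fe Le]]]] := locally_free (vbundle E) x.
  have ue : e \in unitmx by rewrite -row_free_unit.
  have [t tx] := smoothX x.
  have [k Gk tk] := column_reduction (uniformizer_valuation tx) (b *m invmx e).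
  have [V [Vx oV HV]] := GLover_nbhs Gk; have [uk _ _] := Gk.
  have uT : b *m invmx e *m k \in unitmx.
    by rewrite !unitmx_mul ub unitmx_inv ue.
  (* Near [x], [k] is in GL_n of the local rings, so [invmx k *m e] is still a frame, and it differs
     from [b] by a triangular matrix. The constant factor [invmx gF] passes from the triangular
     group to the Borel subgroup given by [g]. *)
  exists (U `&` V, invmx gF *m (invmx k *m e)); split => /=.
  - by split.
  - exact: zariski_openI.
  - split; first by rewrite row_free_unit !unitmx_mul !unitmx_inv ugF uk.
    move=> y [Uy Vy]; rewrite Le //.
    rewrite (mx_span_GL _ (GLoverV (GLover_constants y ug))).
    by rewrite (mx_span_GL _ (GLoverV (HV y Vy))).
  - exists (invmx (b *m invmx e *m k)).
      by rewrite unitmx_inv; split => //; exact: trig_invmx.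
    rewrite mulKVmx // !invmx_mul ?unitmx_mul ?unitmx_inv ?ub //.
    by rewrite invmxK -!mulmxA mulVmx // mulmx1.
have [Ue HUe] := choice frame.
exists (fun x => (Ue x).1), (fun x => (Ue x).2); split.
- by move=> x; have [] := HUe x.
- move=> x y.
  have [_ _ _ [S [uS tS] SE]] := HUe x.
  have [_ _ [fe _] [T [uT tT] TE]] := HUe y.
  have ue : (Ue y).2 \in unitmx by rewrite -row_free_unit.
  rewrite /in_borel -/gF.
  have -> : gF *m ((Ue x).2 *m invmx (Ue y).2) *m invmx gF = S *m invmx T.
    rewrite mulmxA SE -mulmxA -invmx_mul // TE invmx_mul // mulmxA.
    by rewrite mulmxK.
  by apply: trig_mulmx => //; exact: trig_invmx.
- move=> x D; have [_ _ [fe _] [S [uS tS] SE]] := HUe x.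
  have ue : (Ue x).2 \in unitmx by rewrite -row_free_unit.
  rewrite /in_borel -/gF.
  have -> : gF *m ((Ue x).2 *m phi E D *m invmx (Ue x).2) *m invmx gF =
      S *m (b *m phi E D *m invmx b) *m invmx S.
    by rewrite !mulmxA SE -[LHS]mulmxA -invmx_mul // SE invmx_mul // !mulmxA.
  by apply: trig_mulmx; [exact: trig_mulmx|exact: trig_invmx].
Qed.

Lemma frame_regular E (x : point X) D (e : 'M[F]_n) : e \in unitmx ->
  vbundle E x = mx_span x e -> tangent x D ->
  e *m phi E D *m invmx e \is a mxOver (loc_ring x).
Proof.
move=> ue Le tD; apply/mxOverP => i j.
have ei : vbundle E x (row i e).
  rewrite Le; exists (row i 1%:M) => /=; last by rewrite -row_mul mul1mx.
  by apply/mxOverP => k l; rewrite mxE (mxOverP (mxOver1 _ _)).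
have := phi_regular tD ei; rewrite Le => -[v /mxOverP ov vE].
suff -> : (e *m phi E D *m invmx e) i j = v 0 j by exact: ov.
have -> : v = row i (e *m phi E D *m invmx e) by rewrite !row_mul -vE mulmxK.
by rewrite [RHS]mxE.
Qed.

(** The eigenvalues are the diagonal entries in an adapted frame. A triangular change of frame
    preserves them, so those read at [x0] are regular at every point. *)
Lemma borel_reduction_eigenvalues g E : g \in unitmx -> borel_reduction g E ->
  exists alpha, forall D, char_poly (phi E D) = \prod_i ('X - (alpha i D)%:P).
Proof.
move=> ug [U [e [fe te tphi]]]; have [x0] := point_exists X.
(* In the frames [a x] the Borel subgroup given by [g] becomes the group of lower triangular
   matrices. *)
have [a aE] : exists a, forall x, a x = map_mx c g *m e x.
  by exists (fun x => map_mx c g *m e x).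
have ue x : e x \in unitmx by have [_ _ [+ _]] := fe x; rewrite row_free_unit.
have ugF : map_mx c g \in unitmx by rewrite map_unitmx.
have ua x : a x \in unitmx by rewrite aE unitmx_mul ugF ue.
pose T x D := a x *m phi E D *m invmx (a x).
have tT x D : is_trig_mx (T x D).
  by have := tphi x D; rewrite /in_borel /T aE invmx_mul // !mulmxA.
have Tdiag x y D i : T x D i i = T y D i i.
  pose S := a x *m invmx (a y).
  have tS : is_trig_mx S.
    by have := te x y; rewrite /in_borel /S !aE invmx_mul // !mulmxA.
  have uS : S \in unitmx by rewrite unitmx_mul ua unitmx_inv ua.
  have TS : T x D *m S = S *m T y D.
    by rewrite /T /S !mulmxA mulmxKV // mulmxKV.
  have /matrixP/(_ i i) := TS.
  rewrite (trig_mulmx_diag _ (tT x D) tS) (trig_mulmx_diag _ tS (tT y D)).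
  rewrite mulrC => /mulfI; apply.
  exact: trig_unitmx_diag_neq0.
have homog i f D : T x0 (f *: D) i i = f ^+ 1 * T x0 D i i.
  by rewrite /T linearZ -scalemxAr -scalemxAl mxE.
have reg i x D : tangent x D -> T x0 D i i \in loc_ring x.
  move=> tD; rewrite (Tdiag x0 x); have [Ux _ [_ Le]] := fe x.
  suff /mxOverP : T x D \is a mxOver (loc_ring x) by apply.
  apply: frame_regular => //; rewrite Le // aE.
  by rewrite mx_span_GL //; exact: GLover_constants.
exists (fun i => Pluricanonical (homog i) (reg i)) => D.
by rewrite -(char_poly_conj _ (ua x0)) char_poly_trig ?tT.
Qed.

Lemma pluricanonical_eq j (p q : pluricanonical X j) : p =1 q -> p = q.
Proof.
case: p q => p hp rp [q hq rq] /= /funext pq; case: q / pq in hq rq *.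
by congr Pluricanonical; exact: Prop_irrelevance.
Qed.

Lemma char_poly_eq (A B : 'M[F]_n) :
  (forall i, char_coef i A = char_coef i B) -> char_poly A = char_poly B.
Proof.
move=> AB; apply/polyP => j; case: (ltngtP j n) => [lt|lt|->].
(* The coefficient of degree [j] is [char_coef] at the index [n - j.+1]; the leading one is not
   among the [char_coef] but equals 1. *)
- have lt' : (n - j.+1 < n)%N by rewrite ltn_subrL (leq_ltn_trans _ lt).
  have := AB (Ordinal lt'); rewrite /char_coef /=.
  by rewrite subnSK // subKn // ltnW.
- by rewrite !nth_default ?size_char_poly.
- have mono (M : 'M[F]_n) : (char_poly M)`_n = 1.
    by have /monicP := char_poly_monic M; rewrite lead_coefE size_char_poly.
  by rewrite !mono.
Qed.

Lemma hitchin_diagP E alpha : hitchin_higgs E = diag_hitchin alpha <->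
  forall D, char_poly (phi E D) = \prod_i ('X - (alpha i D)%:P).
Proof.
have diagE D : char_poly (diag_field alpha D) = \prod_i ('X - (alpha i D)%:P).
  rewrite char_poly_trig ?diag_mx_is_trig //; apply: eq_bigr => i _.
  by rewrite !mxE eqxx.
split=> [hE D|hE].
  rewrite -diagE; apply: char_poly_eq => i.
  exact: (congr1 (fun q : hitchin_base X n => q i D) hE).
apply/functional_extensionality_dep => i; apply: pluricanonical_eq => D /=.
by rewrite /char_coef hE diagE.
Qed.

Lemma higgs_iso_refl E : higgs_iso E E.
Proof.
exists 1%:M; [exact: unitmx1|split] => [x|D]; last by rewrite mul1mx mulmx1.
by apply/seteqP; split=> [v Lv|_ [v Lv <-]]; [exists v|]; rewrite ?mulmx1.
Qed.

Lemma higgs_iso_char_poly E E' D :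
  higgs_iso E E' -> char_poly (phi E' D) = char_poly (phi E D).
Proof.
move=> [h uh [_ hphi]].
by rewrite -(char_poly_conj _ uh) hphi mulmxK.
Qed.

(** All [phi E D] are multiples of a single [phi E D0], so a basis that trigonalizes this one serves
    for all. *)
Lemma simultaneous_trigonalization E alpha :
  (forall D, char_poly (phi E D) = \prod_i ('X - (alpha i D)%:P)) ->
  exists2 b, b \in unitmx & forall D, is_trig_mx (b *m phi E D *m invmx b).
Proof.
move=> cE; have [D0 D0P] := der_dim1 X.
have [|b ub tb] := @trigonalize _ _ (phi E D0) [seq alpha i D0 | i : 'I_n].
  by rewrite cE big_map big_enum.
exists b => // D; have [f ->] := D0P D; rewrite linearZ -scalemxAr -scalemxAl.
by apply/is_trig_mxP => i j /(is_trig_mxP tb) ij; rewrite mxE ij mulr0.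
Qed.

End HiggsBundles.

Theorem proposition3p2 (R : realType) (X : curve R) (smoothX : smooth X)
    (n : nat) (n_gt0 : (0 < n)%N)
    (g : 'M[R[i]]_n) (g_unit : g \in unitmx) :
  @hitchin R X n @^-1` @sym_locus R X n = @bor R X n g.
Proof.
apply/seteqP; split => m; rewrite /preimage /= /hitchin;
  case: cid => E [pE dE mE] /=.
  move=> [alpha _ /esym/hitchin_diagP/simultaneous_trigonalization[b ub tb]].
  exists E; first by rewrite mE; exact: higgs_iso_refl.
  exact: borel_reduction_trig tb.
(* The reduction may belong to another representative [E'] of the class; it has the same
   characteristic polynomials as [E]. *)
move=> [E' mE' /(borel_reduction_eigenvalues g_unit)[alpha aE]].
exists alpha => //; apply/esym/hitchin_diagP => D.
by rewrite -aE; apply/esym/higgs_iso_char_poly; rewrite -mE.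
Qed.
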